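(* For every integer $k\geq 1$, the second largest element of $\widetilde{H}(\infty,k)$ equals $2^{k-1}$, and the second largest element of $\widehat{H}(\infty,k)$ also equals $2^{k-1}$ (the largest element of both sets being $2^k$). Moreover, $2^{k-1}\in\widehat{H}(n,k)$ for all integers $n\geq 2k$, and $2^{k-1}\in\widetilde{H}(n,k)$ for all integers $n>k$.
   Context: Let $\mathbb{H}^n:=\{0,1\}^n\subset\mathbb{R}^n$, and equip $\mathbb{R}^n$ with the Euclidean norm $\|\cdot\|$. A linear map $L:\mathbb{R}^k\to\mathbb{R}^m$ is a contraction if $\|Lv\|\leq\|v\|$ for all $v$, and an isometry if $\|Lv\|=\|v\|$ for all $v$. For integers $n\geq k\geq 1$ and $m=n-k$, let $\widetilde{H}(n,k)=\{t:\exists\, L:\mathbb{R}^k\to\mathbb{R}^m \text{ linear contraction},\ t=|\mathbb{H}^k\cap L^{-1}(\mathbb{H}^m)|\}$. For $n\geq 2k$ (i.e. $m\geq k$), let $\widehat{H}(n,k)=\{t:\exists\, L:\mathbb{R}^k\to\mathbb{R}^m \text{ linear isometry},\ t=|\mathbb{H}^k\cap L^{-1}(\mathbb{H}^m)|\}$. Define $\widetilde{H}(\infty,k):=\bigcup_{n\geq k}\widetilde{H}(n,k)$ and $\widehat{H}(\infty,k):=\bigcup_{n\geq 2k}\widehat{H}(n,k)$. *)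

(* Defs.v *)
From mathcomp Require Import all_boot all_order all_algebra.
From mathcomp Require Import boolp classical_sets functions cardinality reals.

Set Implicit Arguments.
Unset Strict Implicit.
Unset Printing Implicit Defensive.

Import Order.TTheory GRing.Theory Num.Theory.
Local Open Scope classical_set_scope.
Local Open Scope ring_scope.

Section Hypercubes.
Variable R : realType.

(* MathComp-Analysis equips 'rV[R]_n with the sup norm, hence this definition. *)
Definition enorm (n : nat) (v : 'rV[R]_n) : R :=
  Num.sqrt (\sum_(i < n) v 0 i ^+ 2).

Definition lin_contraction (k m : nat) (L : {linear 'rV[R]_k -> 'rV[R]_m}) :
  Prop := forall v, enorm (L v) <= enorm v.

Definition lin_isometry (k m : nat) (L : {linear 'rV[R]_k -> 'rV[R]_m}) :
  Prop := forall v, enorm (L v) = enorm v.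

Definition hypercube (n : nat) : set 'rV[R]_n :=
  [set v | forall i, v 0 i = 0 \/ v 0 i = 1].
Arguments hypercube : clear implicits.

Definition hypercube_count (k m : nat) (L : {linear 'rV[R]_k -> 'rV[R]_m})
  (t : nat) : Prop := (hypercube k `&` L @^-1` hypercube m #= `I_t)%card.

(* The subtraction [n - k] is truncated: [Htilde n k] is meaningful only for
   [k <= n], and [Hhat n k] only for [2 * k <= n]. *)
Definition Htilde (n k : nat) : set nat :=
  [set t | exists L : {linear 'rV[R]_k -> 'rV[R]_(n - k)},
    lin_contraction L /\ hypercube_count L t].

Definition Hhat (n k : nat) : set nat :=
  [set t | exists L : {linear 'rV[R]_k -> 'rV[R]_(n - k)},
    lin_isometry L /\ hypercube_count L t].

Definition Htilde_oo (k : nat) : set nat :=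
  \bigcup_(n in [set n | (k <= n)%N]) Htilde n k.

Definition Hhat_oo (k : nat) : set nat :=
  \bigcup_(n in [set n | (2 * k <= n)%N]) Hhat n k.

End Hypercubes.

Definition largest (A : set nat) (x : nat) : Prop := A x /\ ubound A x.

Definition second_largest (A : set nat) (x : nat) : Prop :=
  exists2 y, largest A y & largest (A `\ y) x.

(* Main.v *)
Require Import Defs.
From mathcomp Require Import all_boot all_order all_algebra.
From mathcomp Require Import boolp classical_sets functions cardinality reals.
From mathcomp Require Import lra.

(** If more than half of the vertices of the cube are good (mapped by [L] into
    the target cube), then by pigeonhole every direction [i] carries an edge
    with two good endpoints, so [L e_i] is a difference of cube vertices and
    the matrix of [L] has entries in {-1, 0, 1}. A contraction has rows of norm
    at most 1, so each row has at most one nonzero entry, and an entry -1 in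
    direction [i] would send one end of the good [i]-edge outside the cube.
    Every coordinate of [L] is thus 0 or a coordinate function, and all
    vertices are good. The values 2^k and 2^(k-1) come from the truncation
    [x |-> (± x_0, x_1, ...)]. *)

Set Implicit Arguments.
Unset Strict Implicit.
Unset Printing Implicit Defensive.

Import Order.TTheory GRing.Theory Num.Theory.
Local Open Scope classical_set_scope.
Local Open Scope ring_scope.

(** * Counting in families of finite sets *)

Lemma card_eq_finset (T : finType) (F : {set T}) : ([set` F] #= `I_#|F|)%card.
Proof.
have -> : [set` F] = range (@enum_val T (mem F)).
  apply/seteqP; split => [x /= xF|x [i _ <-]]; last exact: enum_valP.
  by exists (enum_rank_in xF x) => //; rewrite enum_rankK_in.
apply: card_eq_trans (_ : ([set: 'I_#|F|] #= _)%card).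
  by apply: inj_card_eq => i j _ _; apply: enum_val_inj.
by rewrite card_eq_sym; exact: card_II.
Qed.

(** Without such an edge, deleting [i] is injective on [F], and its image lies among the subsets of
    the complement of [i], of which there are only [2 ^ #|T|.-1]. *)
Lemma exists_edge_of_half (T : finType) (F : {set {set T}}) (i : T) :
  (2 ^ #|T|.-1 < #|F|)%N ->
  exists A : {set T}, [/\ i \notin A, A \in F & (i |: A)%SET \in F].
Proof.
move=> half; apply: contrapT => noedge; move: half; apply/negP; rewrite -leqNgt.
have D1id (A : {set T}) : i \notin A -> (A :\ i)%SET = A.
  by move=> iA; apply/finset.setDidPl; rewrite disjoint_sym disjoints1.
have edge A B : A \in F -> B \in F -> i \in A -> i \notin B ->
    (A :\ i)%SET <> (B :\ i)%SET.
  move=> AF BF iA iB AB; apply: noedge; exists B; split => //.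
  by rewrite -(D1id B iB) -AB finset.setD1K.
have /card_in_imset <- : {in F &, injective (fun A : {set T} => (A :\ i)%SET)}.
  move=> A B AF BF /= AB.
  have [iA|iA] := boolP (i \in A); have [iB|iB] := boolP (i \in B).
  - by rewrite -(finset.setD1K iA) AB finset.setD1K.
  - by case: (edge A B).
  - by case: (edge B A).
  - by rewrite -(D1id A) // AB D1id.
rewrite -(cardsC1 i) -finset.card_powerset.
apply/subset_leq_card/fintype.subsetP => _ /imsetP[A _ ->].
by rewrite finset.powersetE finset.setDE finset.subsetIr.
Qed.

(** * Cube vertices as finite sets *)

Section Cubes.
Variable R : realType.

(** Indexing vertices by subsets makes the good ones a [finType] set, open to counting and
    pigeonhole. *)
Definition vertex k (A : {set 'I_k}) : 'rV[R]_k := \row_i (i \in A)%:R.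

Lemma vertex_inj k : injective (@vertex k).
Proof.
move=> A B /rowP AB; apply/finset.setP => i; move: (AB i); rewrite !mxE => /eqP.
by rewrite eqr_nat; case: (i \in A); case: (i \in B).
Qed.

Lemma hypercubeE k : @hypercube R k = range (@vertex k).
Proof.
apply/seteqP; split => [v vH|_ [A _ <-] i]; last first.
  by rewrite mxE; case: (i \in A); [right|left].
exists [set i | v 0 i == 1]%SET => //; apply/rowP => i; rewrite mxE inE.
by case: (vH i) => ->; rewrite ?eqxx // eq_sym oner_eq0.
Qed.

Definition good_vertices k m (L : 'rV[R]_k -> 'rV[R]_m) : {set {set 'I_k}} :=
  [set A | `[< @hypercube R m (L (vertex A)) >]]%SET.

Lemma good_verticesP k m (L : 'rV[R]_k -> 'rV[R]_m) A :
  reflect (@hypercube R m (L (vertex A))) (A \in good_vertices L).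
Proof. by rewrite inE; exact: asboolP. Qed.

(** Equipotent initial segments of the naturals have equal length, so [t] is determined by [L]. *)
Lemma hypercube_countE k m (L : {linear 'rV[R]_k -> 'rV[R]_m}) (t : nat) :
  hypercube_count L t <-> t = #|good_vertices L|.
Proof.
have E : (@hypercube R k `&` L @^-1` @hypercube R m #= `I_#|good_vertices L|)%card.
  have -> : @hypercube R k `&` L @^-1` @hypercube R m =
            @vertex k @` [set` good_vertices L].
    rewrite hypercubeE; apply/seteqP; split => [_ [[A _ <-] gA]|_ [A + <-]].
      by exists A => //; apply/good_verticesP.
    by move=> /good_verticesP gA; split => //; exists A.
  apply: card_eq_trans (card_eq_finset _).
  by apply: inj_card_eq => A B _ _; apply: vertex_inj.
rewrite /hypercube_count; split => [|-> //].
by rewrite (card_eql E) => /card_eq_II.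
Qed.

Lemma enorm_le k m (u : 'rV[R]_k) (v : 'rV[R]_m) :
  (enorm u <= enorm v) = (\sum_i u 0 i ^+ 2 <= \sum_i v 0 i ^+ 2).
Proof. by rewrite /enorm ler_sqrt // sumr_ge0 // => i _; apply: sqr_ge0. Qed.

(** * Contractions with more than half of the vertices good *)

Section Contraction.
Variables (k m : nat) (L : {linear 'rV[R]_k -> 'rV[R]_m}).
Hypothesis contrL : lin_contraction L.

Let c i j : R := L (delta_mx 0 i) 0 j.

Lemma linear_rV_coordE v j : L v 0 j = \sum_i v 0 i * c i j.
Proof.
rewrite {1}(row_sum_delta v) linear_sum summxE.
by apply: eq_bigr => i _; rewrite linearZ mxE.
Qed.

(* Apply the contraction to the row itself: |c_j|^4 <= |L c_j|^2 <= |c_j|^2. *)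
Lemma contraction_row_le1 j : \sum_i c i j ^+ 2 <= 1.
Proof.
set s := \sum_i _; pose v : 'rV[R]_k := \row_i c i j.
have s_ge0 : 0 <= s by apply: sumr_ge0 => i _; apply: sqr_ge0.
have := contrL v; rewrite enorm_le.
have -> : \sum_i v 0 i ^+ 2 = s by apply: eq_bigr => i _; rewrite mxE.
rewrite (bigD1 j) //=.
have -> : L v 0 j = s.
  by rewrite linear_rV_coordE; apply: eq_bigr => i _; rewrite mxE expr2.
have : 0 <= \sum_(i | i != j) L v 0 i ^+ 2.
  by apply: sumr_ge0 => i _; apply: sqr_ge0.
(* The squared norm of the image is at least [s ^+ 2], so [s ^+ 2 <= s], which excludes [s > 1]. *)
by move=> *; rewrite leNgt; apply/negP => ?; nra.
Qed.

Lemma vertexU1 (A : {set 'I_k}) i :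
  i \notin A -> vertex (i |: A)%SET = delta_mx 0 i + vertex A.
Proof.
move=> iA; apply/rowP => l; rewrite !mxE /= !inE.
by have [->|_] := eqVneq l i; rewrite ?(negbTE iA) ?addr0 ?add0r.
Qed.

Lemma good_vertices_full :
  (2 ^ k.-1 < #|good_vertices L|)%N -> good_vertices L = finset.setT.
Proof.
move=> half.
have edge i : exists A : {set 'I_k}, [/\ i \notin A,
    @hypercube R m (L (vertex A)) & @hypercube R m (L (vertex (i |: A)%SET))].
  have [|A [iA]] := @exists_edge_of_half _ (good_vertices L) i.
    by rewrite card_ord.
  by move=> /good_verticesP gA /good_verticesP gB; exists A.
(* Along a good edge in direction [i], coordinate [j] changes by [c i j], while both of its values
   are 0 or 1. *)
have c01 i j : c i j = 0 \/ c i j ^+ 2 = 1.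
  have [A [iA /(_ j) gA /(_ j)]] := edge i.
  rewrite vertexU1 // linearD mxE -/(c i j).
  case: gA => ->.
    by rewrite addr0 => -[->|->]; [left|right; rewrite expr1n].
  case=> h; last by left; lra.
  have -> : c i j = -1 by lra.
  by right; rewrite sqrrN expr1n.
(* Two nonzero entries with the same [j] would have squares summing to 2, above the bound 1. *)
have c_uniq i j : c i j != 0 -> forall l, l != i -> c l j = 0.
  move=> ci l li; have := contraction_row_le1 j.
  rewrite (bigD1 i) //= (bigD1 l) //=.
  have : 0 <= \sum_(p | (p != i) && (p != l)) c p j ^+ 2.
    by apply: sumr_ge0 => p _; apply: sqr_ge0.
  case: (c01 i j) ci => [->|-> _]; first by rewrite eqxx.
  by case: (c01 l j) => // ->; lra.
have LE i j A : c i j != 0 -> L (vertex A) 0 j = (i \in A)%:R * c i j.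
  move=> ci; rewrite linear_rV_coordE (bigD1 i) //= mxE big1 ?addr0 // => l li.
  by rewrite (c_uniq i) ?mulr0.
apply/finset.setP => A; rewrite finset.in_setT; apply/good_verticesP => j.
have [/existsP[i ci]|/existsPn c0] := boolP [exists i, c i j != 0]; last first.
  left; rewrite linear_rV_coordE big1 // => i _.
  by have /negPn/eqP -> := c0 i; rewrite mulr0.
(* At the end [i |: B] of the good edge, coordinate [j] equals [c i j]; being nonzero, it must be 1,
   which rules out -1. *)
have [B [_ _ /(_ j)]] := edge i.
rewrite !(LE i) // !inE eqxx mul1r.
case=> [/eqP|->]; first by rewrite (negbTE ci).
by rewrite mulr1; case: (i \in A); [right|left].
Qed.

Lemma contraction_count_dichotomy t :
  hypercube_count L t -> t = (2 ^ k)%N \/ (t <= 2 ^ k.-1)%N.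
Proof.
move=> /hypercube_countE ->; case: leqP => [|half]; [by right|left].
rewrite good_vertices_full // cardsE.
have := card_powerset [set: 'I_k]%SET.
by rewrite finset.powersetT !cardsT card_ord => ->.
Qed.

End Contraction.

(** * Signed truncations and their counts *)

Section Truncation.
Variables (b : bool) (k m : nat).

(** Coordinates are dropped when [m < k] and padded with zeros when [k <= m]; [b] decides whether
    coordinate 0 changes sign. *)
Definition truncation_mx : 'M[R]_(k, m) :=
  \matrix_(i, j) ((-1) ^+ (b && (i == 0%N :> nat)) *+ (i == j :> nat)).

Definition truncation : {linear 'rV[R]_k -> 'rV[R]_m} := mulmxr truncation_mx.

Lemma truncationE v (j : 'I_m) (i : 'I_k) : i = j :> nat ->
  truncation v 0 j = (-1) ^+ (b && (i == 0%N :> nat)) * v 0 i.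
Proof.
move=> ij; rewrite mxE (bigD1 i) //= mxE ij eqxx mulrC big1 ?addr0 // => l li.
by rewrite mxE -ij -[(l == i :> nat)]/(l == i) (negbTE li) mulr0n mulr0.
Qed.

Lemma truncation_eq0 v (j : 'I_m) : (k <= j)%N -> truncation v 0 j = 0.
Proof.
move=> kj; rewrite mxE big1 // => l _.
by rewrite mxE (@ltn_eqF l j) ?mulr0 // (leq_trans _ kj).
Qed.

(** Each source coordinate [i < m] survives exactly once, up to sign; both the contraction and the
    isometry property follow. *)
Lemma sum_sqr_truncation v :
  \sum_j truncation v 0 j ^+ 2 = \sum_(i < k | (i < m)%N) v 0 i ^+ 2.
Proof.
under eq_bigr => j _.
  have -> : truncation v 0 j ^+ 2 = \sum_(i < k | i == j :> nat) v 0 i ^+ 2.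
    have [jk|kj] := ltnP j k; last first.
      rewrite truncation_eq0 // expr0n big1 // => i /eqP ij.
      by move: (ltn_ord i); rewrite ij ltnNge kj.
    rewrite (big_pred1 (Ordinal jk)) //.
    by rewrite (truncationE _ (i := Ordinal jk)) // exprMn sqrr_sign mul1r.
  over.
rewrite (exchange_big_dep (fun i : 'I_k => (i < m)%N)) /=; last first.
  by move=> i j _ /eqP ->.
by apply: eq_bigr => i im; rewrite (big_pred1 (Ordinal im)) // => j; apply: eq_sym.
Qed.

Lemma truncation_contraction : lin_contraction truncation.
Proof.
move=> v; rewrite enorm_le sum_sqr_truncation [leRHS](bigID (fun i : 'I_k => (i < m)%N)).
by rewrite lerDl sumr_ge0 // => i _; apply: sqr_ge0.
Qed.

Lemma truncation_isometry : (k <= m)%N -> lin_isometry truncation.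
Proof.
move=> km v; rewrite /enorm sum_sqr_truncation; congr Num.sqrt.
by apply: eq_bigl => i; rewrite (leq_trans (ltn_ord i) km).
Qed.

(** The only possible failure is the value -1, produced when coordinate 0 is flipped, retained and
    equal to 1. *)
Lemma truncation_good (A : {set 'I_k}) :
  (A \in good_vertices truncation) =
  [forall i : 'I_k, [&& b, i == 0%N :> nat & (i < m)%N] ==> (i \notin A)].
Proof.
apply/good_verticesP/forallP => [gA i|gA j].
  apply/implyP => /and3P[b1 i0 im]; have := gA (Ordinal im).
  rewrite (truncationE _ (i := i)) // mxE b1 i0 expr1.
  by case: (i \in A) => //; rewrite mulr1 => -[] h; exfalso; lra.
have [jk|kj] := ltnP j k; last by left; rewrite truncation_eq0.
rewrite (truncationE _ (i := Ordinal jk)) // mxE /=.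
move: (gA (Ordinal jk)); rewrite /= ltn_ord andbT => /implyP.
case: (b && _) => [/(_ isT) /negbTE ->|_]; first by left; rewrite mulr0.
by rewrite expr0 mul1r; case: (_ \in A); [right|left].
Qed.

End Truncation.

Lemma truncation_count_full k m :
  hypercube_count (truncation false k m) (2 ^ k)%N.
Proof.
apply/hypercube_countE; rewrite (_ : good_vertices _ = powerset finset.setT).
  by rewrite finset.card_powerset cardsT card_ord.
apply/finset.setP => A; rewrite truncation_good finset.powersetT inE.
by apply/forallP => i.
Qed.

(** The successors ensure that coordinate 0 exists and is retained, so the good sets are exactly
    those avoiding [ord0]. *)
Lemma truncation_count_half k m :
  hypercube_count (truncation true k.+1 m.+1) (2 ^ k)%N.
Proof.
apply/hypercube_countE.
rewrite (_ : good_vertices _ = powerset [set~ ord0]%SET).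
  by rewrite finset.card_powerset cardsC1 card_ord.
apply/finset.setP => A; rewrite truncation_good finset.powersetE.
rewrite finset.subsetC finset.sub1set inE.
apply/forallP/idP => [/(_ ord0)//|A0 i].
by apply/implyP => /and3P[_ /eqP i0 _]; rewrite (_ : i = ord0) //; exact: val_inj.
Qed.

(** * Attained values and the gap below the maximum *)

Lemma Hhat_full n k : (2 * k <= n)%N -> Hhat R n k (2 ^ k)%N.
Proof.
rewrite mul2n -addnn => kn; exists (truncation false k (n - k)).
split; last exact: truncation_count_full.
by apply: truncation_isometry; rewrite leq_subRL // (leq_trans _ kn) ?leq_addr.
Qed.

Lemma Hhat_half n k : (0 < k)%N -> (2 * k <= n)%N -> Hhat R n k (2 ^ (k - 1))%N.
Proof.
rewrite mul2n -addnn => k_gt0 kn; exists (truncation true k (n - k)).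
have km : (k <= n - k)%N by rewrite leq_subRL // (leq_trans _ kn) ?leq_addr.
split; first exact: truncation_isometry.
case: k (n - k)%N k_gt0 km {kn} => // k [] // m _ _.
by rewrite subn1; exact: truncation_count_half.
Qed.

(** Strictness [k < n] makes the target dimension positive, so the flipped coordinate is
    retained. *)
Lemma Htilde_half n k : (0 < k < n)%N -> Htilde R n k (2 ^ (k - 1))%N.
Proof.
move=> /andP[k_gt0 kn]; exists (truncation true k (n - k)).
split; first exact: truncation_contraction.
have := kn; rewrite -subn_gt0; case: k (n - k)%N k_gt0 {kn} => // k [] // m _ _.
by rewrite subn1; exact: truncation_count_half.
Qed.

(** Isometries are contractions; the inclusion carries attained values up to [Htilde_oo] and the
    dichotomy down to [Hhat_oo]. *)
Lemma sub_Hhat_oo_Htilde_oo k : Hhat_oo R k `<=` Htilde_oo R k.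
Proof.
move=> t [n /= kn [L [isoL cL]]]; exists n => /=.
  by rewrite (leq_trans _ kn) // leq_pmull.
by exists L; split => // v; rewrite isoL.
Qed.

Lemma Htilde_oo_dichotomy k t :
  Htilde_oo R k t -> t = (2 ^ k)%N \/ (t <= 2 ^ (k - 1))%N.
Proof.
by move=> [n _ [L [contrL]]]; rewrite subn1; exact: contraction_count_dichotomy.
Qed.

End Cubes.

Lemma largest_second_largest (A : set nat) (x y : nat) : (y < x)%N ->
  A x -> A y -> (forall t, A t -> t = x \/ (t <= y)%N) ->
  largest A x /\ second_largest A y.
Proof.
move=> yx Ax Ay dich; have maxA : largest A x.
  split=> // t /dich[->//|ty]; exact: leq_trans ty (ltnW yx).
split=> //; exists x => //; split.
  by split=> // yE; rewrite yE ltnn in yx.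
by move=> t [/dich[->/(_ erefl)|]].
Qed.

Theorem theorem4p1 (R : realType) (k : nat) (hk : (1 <= k)%N) :
  (largest (Htilde_oo R k) (2 ^ k)%N /\
   second_largest (Htilde_oo R k) (2 ^ (k - 1))%N) /\
  (largest (Hhat_oo R k) (2 ^ k)%N /\
   second_largest (Hhat_oo R k) (2 ^ (k - 1))%N) /\
  (forall n : nat, (2 * k <= n)%N -> Hhat R n k (2 ^ (k - 1))%N) /\
  (forall n : nat, (k < n)%N -> Htilde R n k (2 ^ (k - 1))%N).
Proof.
have lt2 : (2 ^ (k - 1) < 2 ^ k)%N by rewrite ltn_exp2l // subn1 prednK.
(* Both values are attained at [n = 2 * k], where source and target have the same dimension [k]. *)
have full : Hhat_oo R k (2 ^ k)%N.
  by exists (2 * k)%N => /=; [|exact: Hhat_full].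
have half : Hhat_oo R k (2 ^ (k - 1))%N.
  by exists (2 * k)%N => /=; [|exact: Hhat_half].
split.
  apply: largest_second_largest => //; try exact: sub_Hhat_oo_Htilde_oo.
  exact: Htilde_oo_dichotomy.
split.
  apply: largest_second_largest => // t /sub_Hhat_oo_Htilde_oo.
  exact: Htilde_oo_dichotomy.
split=> n kn; first exact: Hhat_half.
by apply: Htilde_half; rewrite hk.
Qed.
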